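(* Let $\mathbb{F}$ be a field with involution $\sigma$, let $\varepsilon\in\mathbb{F}$ satisfy $\varepsilon\bar\varepsilon=1$, and let $\Lambda$ be an additive subgroup of $\mathbb{F}$ with $\Lambda_{min}\le\Lambda\le\Lambda_{max}$. For $\mathbb{F}$-vector spaces $E$: (1) When $\sigma\neq \mathrm{id}$, there is a natural isomorphism $\mathrm{Form}(E,\sigma,\varepsilon,\Lambda)\cong \mathrm{Herm}_{\sigma}(E)$. (2) When $\sigma=\mathrm{id}$, $\varepsilon=-1$ and $\Lambda=\mathbb{F}$, there is a natural isomorphism $\mathrm{Form}(E,\sigma,\varepsilon,\Lambda)\cong \mathrm{Alt}(E)$. (3) When $\sigma=\mathrm{id}$, $\varepsilon=1$ and $\Lambda=0$, there is a natural isomorphism $\mathrm{Form}(E,\sigma,\varepsilon,\Lambda)\cong \mathrm{Quad}(E)$. Here the isomorphisms are isomorphisms of abelian groups, natural in $E$ with respect to linear maps.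
   Context: Let $\mathbb{F}$ be a (commutative) field and $\sigma:\mathbb{F}\to\mathbb{F}$ an involution, i.e. a field automorphism with $\sigma^2=\mathrm{id}$ (possibly $\sigma=\mathrm{id}$); write $\bar x=\sigma(x)$. A map $f:E\times E\to\mathbb{F}$ on an $\mathbb{F}$-vector space $E$ is sesquilinear if it is biadditive and $f(av,bw)=\bar a f(v,w) b$ for all $a,b\in\mathbb{F}$, $v,w\in E$; $\mathrm{Sesq}_\sigma(E)$ denotes the vector space of such maps. For $\varepsilon\in\mathbb{F}$ with $\varepsilon\bar\varepsilon=1$ set $\Lambda_{min}=\{a-\varepsilon\bar a : a\in\mathbb{F}\}$ and $\Lambda_{max}=\{a\in\mathbb{F} : a+\varepsilon\bar a=0\}$. $\mathrm{Form}(E,\sigma,\varepsilon,\Lambda)$ is the quotient group $\mathrm{Sesq}_\sigma(E)/X(E,\sigma,\varepsilon,\Lambda)$, where $X(E,\sigma,\varepsilon,\Lambda)$ is the additive subgroup of all $f\in\mathrm{Sesq}_\sigma(E)$ with $f(v,v)\in\Lambda$ and $f(w,v)=-\varepsilon\overline{f(v,w)}$ for all $v,w\in E$. $\mathrm{Herm}_\sigma(E)$ is the group of sesquilinear $\omega:E\times E\to\mathbb{F}$ with $\omega(v,w)=\overline{\omega(w,v)}$ for all $v,w$. $\mathrm{Alt}(E)$ is the group of bilinear $\omega:E\times E\to\mathbb{F}$ with $\omega(v,v)=0$ for all $v$. $\mathrm{Quad}(E)$ is the group of maps $Q:E\to\mathbb{F}$ with $Q(av)=a^2Q(v)$ for all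 $a\in\mathbb{F}$, $v\in E$, and such that $B_Q(v,w)=Q(v+w)-Q(v)-Q(w)$ is bilinear. All of these are contravariant functors of $E$ from $\mathbb{F}$-vector spaces and linear maps to abelian groups, via pullback: for linear $f:E\to F$, $f^*q(v,w)=q(f(v),f(w))$ (respectively $f^*Q(v)=Q(f(v))$). *)

(* Defs.v *)
From HB Require Import structures.
From mathcomp Require Import all_boot all_algebra.
From mathcomp Require Import boolp classical_sets functions.
From mathcomp Require Import ring.

Set Implicit Arguments.
Unset Strict Implicit.
Unset Printing Implicit Defensive.

Import GRing.Theory.
Import Quotient.

Local Open Scope ring_scope.
Local Open Scope quotient_scope.
Local Open Scope classical_set_scope.

(* A contravariant functor from F-vector spaces (of arbitrary dimension) and
   linear maps to abelian groups. *)
Record vect_presheaf (F : fieldType) := VectPresheaf {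
  ob :> lmodType F -> zmodType ;
  pull : forall E E' : lmodType F, {linear E -> E'} -> {additive ob E' -> ob E} ;
  pull_id : forall (E : lmodType F) (q : ob E), pull (@idfun E) q = q ;
  pull_comp : forall (E E' E'' : lmodType F)
    (f : {linear E -> E'}) (g : {linear E' -> E''}) (q : ob E''),
    pull (g \o f) q = pull f (pull g q)
}.
Arguments pull {F} v {E E'} f.

Definition naturally_isomorphic (F : fieldType) (A B : vect_presheaf F) : Prop :=
  exists phi : forall E : lmodType F, {additive A E -> B E},
    (forall E : lmodType F, bijective (phi E)) /\
    (forall (E E' : lmodType F) (f : {linear E -> E'}) (q : A E'),
        phi E (pull A f q) = pull B f (phi E' q)).

Definition pull2 (E E' V : Type) (f : E -> E') (q : E' -> E' -> V) : E -> E -> V :=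
  fun v w => q (f v) (f w).

Section BilinearFor.
Variables (F : fieldType) (s s' : GRing.Scale.law F F).

Lemma bilinear_forB (E : lmodType F) (p q : E -> E -> F) :
  bilinear_for s s' p -> bilinear_for s s' q -> bilinear_for s s' (p - q).
Proof.
have sB (t : GRing.Scale.law F F) a (x y : F) : t a (x - y) = t a x - t a y.
  have [t0 tD] := GRing.Scale.op_nmod_morphism (s := t) a.
  by apply: (addIr (t a y)); rewrite -tD !subrK.
case=> pl pr [ql qr]; split=> u' a u v.
  have := (pl u' a u v, ql u' a u v) => -[/= e1 e2].
  by rewrite !fctE e1 e2 sB opprD addrACA.
have := (pr u' a u v, qr u' a u v) => -[/= e1 e2].
by rewrite !fctE e1 e2 sB opprD addrACA.
Qed.

Lemma bilinear_for0 (E : lmodType F) : bilinear_for s s' (0 : E -> E -> F).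
Proof.
have s0 (t : GRing.Scale.law F F) a : t a 0 = 0 by case: (GRing.Scale.op_nmod_morphism (s := t) a).
by split=> u' a u v; rewrite /= s0 addr0.
Qed.

Lemma bilinear_for_pull2 (E E' : lmodType F) (f : {linear E -> E'})
    (q : E' -> E' -> F) :
  bilinear_for s s' q -> bilinear_for s s' (pull2 f q).
Proof. by case=> ql qr; split=> u' a u v; rewrite /pull2 linearP ?ql ?qr. Qed.

End BilinearFor.

Section Sesquilinear.
Variables (F : fieldType) (sigma : involutive_rmorphism F).

(* Semilinear in the first argument, linear in the second. *)
Definition sesquilinear (E : lmodType F) (q : E -> E -> F) : Prop :=
  bilinear_for (sigma \; *%R) *%R q.

Lemma sesquilinearP (E : lmodType F) (q : E -> E -> F) :
  sesquilinear q <->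
  [/\ forall v v' w, q (v + v') w = q v w + q v' w,
      forall v w w', q v (w + w') = q v w + q v w' &
      forall a b v w, q (a *: v) (b *: w) = sigma a * q v w * b].
Proof.
split=> [[ql qr]|[qDl qDr qZ]].
  have q0l w : q 0 w = 0.
    have /= := ql w 1 0 0; rewrite scaler0 addr0 rmorph1 mul1r.
    by move=> /eqP; rewrite -subr_eq0 opprD addrA subrr sub0r oppr_eq0 => /eqP.
  have q0r v : q v 0 = 0.
    have /= := qr v 1 0 0; rewrite scaler0 addr0 mul1r.
    by move=> /eqP; rewrite -subr_eq0 opprD addrA subrr sub0r oppr_eq0 => /eqP.
  split=> [v v' w|v w w'|a b v w].
  - by have /= := ql w 1 v v'; rewrite scale1r rmorph1 mul1r.
  - by have /= := qr v 1 w w'; rewrite scale1r mul1r.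
  - have /= := ql (b *: w) a v 0; have /= := qr v b w 0.
    by rewrite !addr0 q0l q0r !addr0 => -> ->; rewrite mulrCA mulrC.
split=> [w a v v'|v a w w'] /=.
  by rewrite qDl -[w in LHS]scale1r qZ mulr1 scale1r.
by rewrite qDr -[v in LHS]scale1r qZ rmorph1 mul1r mulrC scale1r.
Qed.

Definition is_sesq (E : lmodType F) : {pred E -> E -> F} :=
  fun q => `[< sesquilinear q >].

Definition is_herm (E : lmodType F) : {pred E -> E -> F} :=
  fun q => `[< sesquilinear q /\ forall v w, q v w = sigma (q w v) >].

Lemma is_sesq_zmod_closed E : zmod_closed (@is_sesq E).
Proof.
split=> [|p q /asboolP ps /asboolP qs]; apply/asboolP.
  exact: bilinear_for0.
exact: bilinear_forB.
Qed.
HB.instance Definition _ E :=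
  GRing.isZmodClosed.Build _ (@is_sesq E) (@is_sesq_zmod_closed E).

Lemma is_herm_zmod_closed E : zmod_closed (@is_herm E).
Proof.
split=> [|p q /asboolP[ps ph] /asboolP[qs qh]]; apply/asboolP; split.
- exact: bilinear_for0.
- by move=> v w; rewrite /= rmorph0.
- exact: bilinear_forB.
- by move=> v w; rewrite !fctE [p v w]ph [q v w]qh rmorphB.
Qed.
HB.instance Definition _ E :=
  GRing.isZmodClosed.Build _ (@is_herm E) (@is_herm_zmod_closed E).

Record Sesq (E : lmodType F) :=
  MkSesq { sesq_fun :> E -> E -> F ; sesqP : sesq_fun \in @is_sesq E }.
HB.instance Definition _ E := [isSub for @sesq_fun E].
HB.instance Definition _ E := [Choice of Sesq E by <:].
HB.instance Definition _ E := [SubChoice_isSubZmodule of Sesq E by <:].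

Record Herm (E : lmodType F) :=
  MkHerm { herm_fun :> E -> E -> F ; hermP : herm_fun \in @is_herm E }.
HB.instance Definition _ E := [isSub for @herm_fun E].
HB.instance Definition _ E := [Choice of Herm E by <:].
HB.instance Definition _ E := [SubChoice_isSubZmodule of Herm E by <:].

Section Pull.
Variables (E E' : lmodType F) (f : {linear E -> E'}).

Lemma sesq_pull_subproof (q : Sesq E') : pull2 f q \in @is_sesq E.
Proof. by apply/asboolP/bilinear_for_pull2; case: q => q /= /asboolP. Qed.
Definition sesq_pull (q : Sesq E') : Sesq E := MkSesq (sesq_pull_subproof q).

Lemma sesq_pull_zmod_morphism : zmod_morphism sesq_pull.
Proof. by move=> p q; exact/val_inj. Qed.
HB.instance Definition _ :=
  GRing.isZmodMorphism.Build _ _ sesq_pull sesq_pull_zmod_morphism.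

Lemma herm_pull_subproof (q : Herm E') : pull2 f q \in @is_herm E.
Proof.
case: q => q /= /asboolP[qs qh]; apply/asboolP.
by split=> [|v w]; [exact: bilinear_for_pull2 | rewrite /pull2 -qh].
Qed.
Definition herm_pull (q : Herm E') : Herm E := MkHerm (herm_pull_subproof q).

Lemma herm_pull_zmod_morphism : zmod_morphism herm_pull.
Proof. by move=> p q; exact/val_inj. Qed.
HB.instance Definition _ :=
  GRing.isZmodMorphism.Build _ _ herm_pull herm_pull_zmod_morphism.

End Pull.

Program Definition Herm_functor : vect_presheaf F :=
  @VectPresheaf F (fun E => Herm E : zmodType)
    (fun E E' f => herm_pull f : {additive _ -> _}) _ _.
Next Obligation. exact/val_inj. Qed.
Next Obligation. exact/val_inj. Qed.

Section Form.
Variables (eps : F) (Lambda : zmodClosed F).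

Definition Lambda_min : set F := [set a - eps * sigma a | a in setT].
Definition Lambda_max : set F := [set a | a + eps * sigma a = 0].

(* The subgroup X(E, sigma, eps, Lambda). *)
Definition is_null (E : lmodType F) : {pred Sesq E} :=
  fun q => `[< (forall v, q v v \in Lambda) /\
               (forall v w, q w v = - eps * sigma (q v w)) >].

Lemma is_null_zmod_closed E : zmod_closed (@is_null E).
Proof.
split=> [|p q /asboolP[pL ph] /asboolP[qL qh]]; apply/asboolP; split.
- by move=> v; rewrite /= rpred0.
- by move=> v w; rewrite /= rmorph0 mulr0.
- by move=> v; rewrite /= !fctE rpredB.
- by move=> v w; rewrite /= !fctE ph qh rmorphB mulrBr.
Qed.
HB.instance Definition _ E :=
  GRing.isZmodClosed.Build _ (@is_null E) (@is_null_zmod_closed E).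

Definition Form (E : lmodType F) : zmodType := {quot @is_null E}.

Section FormPull.
Variables (E E' : lmodType F) (f : {linear E -> E'}).

Definition form_pull (q : Form E') : Form E := \pi_(Form E) (sesq_pull f (repr q)).

Lemma form_pull_pi (q : Sesq E') :
  form_pull (\pi_(Form E') q) = \pi_(Form E) (sesq_pull f q).
Proof.
apply/eqP; rewrite -idealrBE -raddfB.
have /asboolP[qL qh] : repr (\pi_(Form E') q) - q \in @is_null E'.
  by rewrite idealrBE reprK.
by apply/asboolP; split=> [v|v w]; [exact: qL | exact: qh].
Qed.

Lemma form_pull_zmod_morphism : zmod_morphism form_pull.
Proof.
move=> p q; rewrite -[p]reprK -[q]reprK -raddfB !form_pull_pi.
by rewrite !raddfB.
Qed.
HB.instance Definition _ :=
  GRing.isZmodMorphism.Build _ _ form_pull form_pull_zmod_morphism.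

End FormPull.

Program Definition Form_functor : vect_presheaf F :=
  @VectPresheaf F Form (fun E E' f => form_pull f : {additive _ -> _}) _ _.
Next Obligation.
rewrite -[q]reprK form_pull_pi.
by congr (\pi _); exact/val_inj.
Qed.
Next Obligation.
rewrite -[q]reprK !form_pull_pi reprK.
by congr (\pi _); exact/val_inj.
Qed.

End Form.
End Sesquilinear.

Section Alternating.
Variable F : fieldType.

Definition is_alt (E : lmodType F) : {pred E -> E -> F} :=
  fun q => `[< bilinear_for *%R *%R q /\ forall v, q v v = 0 >].

Lemma is_alt_zmod_closed E : zmod_closed (@is_alt E).
Proof.
split=> [|p q /asboolP[pb pa] /asboolP[qb qa]]; apply/asboolP; split=> //.
- exact: bilinear_for0.
- exact: bilinear_forB.
- by move=> v; rewrite !fctE pa qa subrr.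
Qed.
HB.instance Definition _ E :=
  GRing.isZmodClosed.Build _ (@is_alt E) (@is_alt_zmod_closed E).

Record Alt (E : lmodType F) :=
  MkAlt { alt_fun :> E -> E -> F ; altP : alt_fun \in @is_alt E }.
HB.instance Definition _ E := [isSub for @alt_fun E].
HB.instance Definition _ E := [Choice of Alt E by <:].
HB.instance Definition _ E := [SubChoice_isSubZmodule of Alt E by <:].

Section Pull.
Variables (E E' : lmodType F) (f : {linear E -> E'}).

Lemma alt_pull_subproof (q : Alt E') : pull2 f q \in @is_alt E.
Proof.
case: q => q /= /asboolP[qb qa]; apply/asboolP.
by split=> [|v]; [exact: bilinear_for_pull2 | exact: qa].
Qed.
Definition alt_pull (q : Alt E') : Alt E := MkAlt (alt_pull_subproof q).

Lemma alt_pull_zmod_morphism : zmod_morphism alt_pull.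
Proof. by move=> p q; exact/val_inj. Qed.
HB.instance Definition _ :=
  GRing.isZmodMorphism.Build _ _ alt_pull alt_pull_zmod_morphism.

End Pull.

Program Definition Alt_functor : vect_presheaf F :=
  @VectPresheaf F (fun E => Alt E : zmodType)
    (fun E E' f => alt_pull f : {additive _ -> _}) _ _.
Next Obligation. exact/val_inj. Qed.
Next Obligation. exact/val_inj. Qed.

End Alternating.

Section Quadratic.
Variable F : fieldType.

Definition polar (E : lmodType F) (Q : E -> F) : E -> E -> F :=
  fun v w => Q (v + w) - Q v - Q w.

Definition is_quad (E : lmodType F) : {pred E -> F} :=
  fun Q => `[< (forall a v, Q (a *: v) = a ^+ 2 * Q v) /\
               bilinear_for *%R *%R (polar Q) >].

Lemma is_quad_zmod_closed E : zmod_closed (@is_quad E).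
Proof.
split=> [|P Q /asboolP[Ph Pb] /asboolP[Qh Qb]]; apply/asboolP; split.
- by move=> a v; rewrite /= mulr0.
- suff -> : polar (0 : E -> F) = 0 by exact: bilinear_for0.
  by apply/funext => v; apply/funext => w; rewrite /polar /= !subr0.
- by move=> a v; rewrite !fctE Ph Qh mulrBr.
- suff -> : polar (P - Q) = polar P - polar Q by exact: bilinear_forB.
  apply/funext => v; apply/funext => w; rewrite /polar !fctE.
  by ring.
Qed.
HB.instance Definition _ E :=
  GRing.isZmodClosed.Build _ (@is_quad E) (@is_quad_zmod_closed E).

Record Quad (E : lmodType F) :=
  MkQuad { quad_fun :> E -> F ; quadP : quad_fun \in @is_quad E }.
HB.instance Definition _ E := [isSub for @quad_fun E].
HB.instance Definition _ E := [Choice of Quad E by <:].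
HB.instance Definition _ E := [SubChoice_isSubZmodule of Quad E by <:].

Section Pull.
Variables (E E' : lmodType F) (f : {linear E -> E'}).

Lemma quad_pull_subproof (Q : Quad E') : (Q : E' -> F) \o f \in @is_quad E.
Proof.
case: Q => Q /= /asboolP[Qh Qb]; apply/asboolP; split.
  by move=> a v; rewrite /= linearZ Qh.
suff -> : polar (Q \o f) = pull2 f (polar Q) by exact: bilinear_for_pull2.
by apply/funext => v; apply/funext => w; rewrite /polar /pull2 /= linearD.
Qed.
Definition quad_pull (Q : Quad E') : Quad E := MkQuad (quad_pull_subproof Q).

Lemma quad_pull_zmod_morphism : zmod_morphism quad_pull.
Proof. by move=> p q; exact/val_inj. Qed.
HB.instance Definition _ :=
  GRing.isZmodMorphism.Build _ _ quad_pull quad_pull_zmod_morphism.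

End Pull.

Program Definition Quad_functor : vect_presheaf F :=
  @VectPresheaf F (fun E => Quad E : zmodType)
    (fun E E' f => quad_pull f : {additive _ -> _}) _ _.
Next Obligation. exact/val_inj. Qed.
Next Obligation. exact/val_inj. Qed.

End Quadratic.

(* Main.v *)
From HB Require Import structures.
Require Import Defs.
From mathcomp Require Import all_boot all_algebra.
From mathcomp Require Import boolp classical_sets functions.
From mathcomp Require Import ring.

Set Implicit Arguments.
Unset Strict Implicit.
Unset Printing Implicit Defensive.

Import GRing.Theory.

Local Open Scope ring_scope.
Local Open Scope classical_set_scope.

(** Sending [q] to the pair of [omega v w = q v w + eps * sigma (q w v)] and
    [Q v = q v v] read modulo [Lambda] kills exactly the subgroup X by which
    the group Form is defined; the pairs so obtained are the
    (eps, Lambda)-quadratic forms of Wall and Bak.  Once every such pair is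
    known to come from a sesquilinear form, each of the three cases becomes
    the remark that one component of the pair determines the other.

    - If sigma is not the identity, there is [a] with [a + sigma a = 1].  It
      shows that [Lambda_max] lies in [Lambda_min], so that the condition
      [q v v \in Lambda] follows from the hermitian one, and that [omega]
      is the image of the form [a * omega].  By Hilbert 90 there is a nonzero
      [c] with [sigma c = eps * c], and multiplication by [c] turns
      eps-hermitian forms into hermitian ones ([Form_Herm]).
    - If sigma is the identity, [eps = -1] and [Lambda] is everything, only
      [omega v w = q v w - q w v] is left, an alternating form ([Form_Alt]).
    - If sigma is the identity, [eps = 1] and [Lambda = 0], the form [omega] is
      the polar form of [Q], and only [Q] is left ([Form_Quad]).

    The last two cases need the lifting theorem ([quadratic_pair_lift]): in
    characteristic 2 one cannot divide [omega] by 2.  On a space with an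
    ordered basis one would take the triangular form with entries
    [omega e_i e_j] below the diagonal, [Q e_i] on it and 0 above.  For spaces
    of arbitrary dimension Zorn's lemma gives a maximal subspace that carries a
    lift, and one more row of such a triangular form extends a lift by one
    vector ([lifts_on_adjoin]), so the maximal subspace is the whole space.

    Finally, a natural additive surjection from sesquilinear forms with kernel
    X induces a natural isomorphism on Form ([Form_iso]). *)

(** * Lifting quadratic pairs to sesquilinear forms *)

Section Lift.
Variables (F : fieldType) (sigma : involutive_rmorphism F) (eps : F).
Variable Lambda : zmodClosed F.

(** An (eps, Lambda)-quadratic form in the sense of Wall and Bak, where [Q]
    stands for a map to the quotient of [F] by [Lambda]. *)
Definition quadratic_pair (E : lmodType F) (omega : E -> E -> F) (Q : E -> F) :=
  [/\ sesquilinear sigma omega,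
      forall v w, omega v w = eps * sigma (omega w v),
      forall v, omega v v = Q v + eps * sigma (Q v),
      forall a v, Q (a *: v) - sigma a * a * Q v \in Lambda &
      forall v w, Q (v + w) - Q v - Q w - omega v w \in Lambda].

Variables (E : lmodType F) (omega : E -> E -> F) (Q : E -> F).
Hypothesis omegaQ : quadratic_pair omega Q.

(** [q] is a total function of which only the values on the subspace [U]
    matter.  Linearity in the second argument is forced by semilinearity in the
    first and by the hermitian symmetry. *)
Definition lifts_on (U : set E) (q : E -> E -> F) :=
  [/\ U 0,
      forall a u v, U u -> U v -> U (a *: u + v),
      forall a u v w, U u -> U v -> U w ->
        q (a *: u + v) w = sigma a * q u w + q v w,
      forall v w, U v -> U w -> q v w = omega v w - eps * sigma (q w v) &
      forall v, U v -> q v v - Q v \in Lambda].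

Lemma lifts_on_sesq q : lifts_on setT q -> sesquilinear sigma q.
Proof.
case: omegaQ => [[_ or] _ _ _ _] [_ _ ql qh _]; split=> [w a u v | v a u w] /=.
  exact: ql.
rewrite qh // ql // [q v u]qh // [q v w]qh //.
have /= -> := or v a u w.
by rewrite !rmorphD !rmorphM /= rmorphK; ring.
Qed.

Lemma lifts_on0 : lifts_on [set 0] (fun _ _ => 0).
Proof.
case: omegaQ => [/sesquilinearP[_ _ oZ] oh oQ QZ QD].
split=> //= [a u v -> ->|a u v w _ _ _|v w -> ->|v ->].
- by rewrite scaler0 addr0.
- by rewrite mulr0 addr0.
- have := oZ 0 0 0 0; rewrite !scaler0 mulr0 => ->.
  by rewrite rmorph0 mulr0 subr0.
- have := QZ 0 0; rewrite scaler0 mulr0 mul0r subr0 => Q0.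
  by rewrite sub0r rpredN.
Qed.

(** With [x] placed after [U], the matrix of the extended form is block lower
    triangular: the new row is [omega x] on [U], the new column is 0 on [U], and
    the new diagonal entry is [Q x].  Its symmetrization is
    then [omega], and its diagonal is [Q] modulo [Lambda] because [omega] is
    the polar form of [Q] modulo [Lambda]. *)
Lemma lifts_on_adjoin U q x : lifts_on U q -> ~ U x ->
  exists V p, [/\ lifts_on V p, U `<=` V, V x &
    forall u v, U u -> U v -> p u v = q u v].
Proof.
move=> [U0 Uc ql qh qQ] Ux.
have [/sesquilinearP[oDl oDr oZ] oh oQ QZ QD] := omegaQ.
have UB u v : U u -> U v -> U (u - v).
  by move=> Hu Hv; rewrite addrC -scaleN1r; apply: Uc.
have indep u a u' b : U u -> U u' -> u + a *: x = u' + b *: x ->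
    (u, a) = (u', b).
  move=> Hu Hu' e.
  have e' : (a - b) *: x = u' - u.
    rewrite scalerBl; apply/(addrI u)/(addIr (b *: x)).
    by rewrite addrA subrK e addrC subrKC addrC.
  have ab : a = b.
    (* Otherwise dividing by [a - b] would put [x] in [U]. *)
    apply: contrapT => /eqP; rewrite -subr_eq0 => ab; apply: Ux.
    rewrite -[x]scale1r -(mulVf ab) -scalerA e' -[_ *: _]addr0.
    by apply: Uc => //; exact: UB.
  by move: e; rewrite ab => /addIr ->.
pose dec v := xget (0, 0) [set s | U s.1 /\ v = s.1 + s.2 *: x].
have decE u a : U u -> dec (u + a *: x) = (u, a).
  move=> Hu; rewrite /dec; case: xgetP => [[u' b] _ /= [Hu' e]|/(_ (u, a))[]//].
  exact: indep.
pose p v w := let: (u, a) := dec v in let: (u', b) := dec w in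
  q u u' + sigma a * omega x u' + sigma a * b * Q x.
have pE u a u' b : U u -> U u' -> p (u + a *: x) (u' + b *: x) =
    q u u' + sigma a * omega x u' + sigma a * b * Q x.
  by move=> Hu Hu'; rewrite /p !decE.
have oZl a v w : omega (a *: v) w = sigma a * omega v w.
  by rewrite -[w in LHS]scale1r oZ mulr1.
have oZr b v w : omega v (b *: w) = omega v w * b.
  by rewrite -[v in LHS]scale1r oZ rmorph1 mul1r.
have eq_mem_Lambda (y z : F) : y = z -> y \in Lambda -> z \in Lambda.
  by move=> ->.
have E0 u : u = u + 0 *: x by rewrite scale0r addr0.
exists [set v | exists u a, U u /\ v = u + a *: x], p; split.
- split.
  + by exists 0, 0; split.
  + move=> c _ _ [u [a [Hu ->]]] [u' [b [Hu' ->]]].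
    exists (c *: u + u'), (c * a + b); split; first exact: Uc.
    by rewrite scalerDr scalerDl scalerA addrACA.
  + move=> c _ _ _ [u [a [Hu ->]]] [u' [b [Hu' ->]]] [w [d [Hw ->]]].
    rewrite scalerDr addrACA scalerA -scalerDl !pE ?ql //; last exact: Uc.
    by ring.
  + move=> _ _ [u [a [Hu ->]]] [u' [b [Hu' ->]]].
    rewrite !pE // !rmorphD !rmorphM /= !rmorphK !(oDl, oDr, oZl, oZr) oQ qh //.
    by rewrite (oh u x); ring.
  + move=> _ [u [a [Hu ->]]]; rewrite pE //.
    have h := rpredB (qQ u Hu) (rpredD (QD (a *: x) u) (QZ a x)).
    apply: eq_mem_Lambda h.
    by rewrite oZl [u + _]addrC; ring.
- by move=> u Hu; exists u, 0; split.
- by exists 0, 1; split=> //; rewrite scale1r add0r.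
- by move=> u v Hu Hv; rewrite [u in LHS]E0 [v in LHS]E0 pE // rmorph0; ring.
Qed.

Definition partial_lift := {s : set E * (E -> E -> F) | lifts_on s.1 s.2}.

Definition extends (s t : partial_lift) : Prop :=
  (sval s).1 `<=` (sval t).1 /\
  forall u v, (sval s).1 u -> (sval s).1 v -> (sval t).2 u v = (sval s).2 u v.

(** Two lifts that extend each other may still differ outside their common
    subspace, so this is only a preorder. *)
Definition sub_lift (s t : partial_lift) := `[< extends s t >].

Lemma sub_liftP s t : reflect (extends s t) (sub_lift s t).
Proof. exact: asboolP. Qed.

Lemma sub_lift_refl s : sub_lift s s.
Proof. by apply/sub_liftP; split. Qed.

Lemma sub_lift_trans r s t : sub_lift r s -> sub_lift s t -> sub_lift r t.
Proof.
move=> /sub_liftP[rs ers] /sub_liftP[st est]; apply/sub_liftP; split.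
  exact: subset_trans st.
by move=> u v ru rv; rewrite est ?ers //; exact: rs.
Qed.

(** The union of a chain: any three vectors of the union lie in a single
    member, and every axiom of [lifts_on] involves at most three vectors. *)
Lemma sub_lift_chain (A : set partial_lift) : total_on A sub_lift ->
  exists t, forall s, A s -> sub_lift s t.
Proof.
move=> Atot; have [->|/set0P[s0 As0]] := eqVneq A set0.
  by exists (exist _ (_, _) lifts_on0).
pose dom s := (sval (s : partial_lift)).1.
pose fn s := (sval (s : partial_lift)).2.
have agree s t u v : A s -> A t -> dom s u -> dom s v -> dom t u -> dom t v ->
    fn s u v = fn t u v.
  move=> As At su sv tu tv.
  have [/sub_liftP[_ e]|/sub_liftP[_ e]] := Atot s t As At.
    by rewrite /fn e.
  by rewrite /fn e.
pose U := [set v | exists2 s, A s & dom s v].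
have join s t : A s -> A t ->
    exists r, [/\ A r, dom s `<=` dom r & dom t `<=` dom r].
  move=> As At; have [/sub_liftP[st _]|/sub_liftP[ts _]] := Atot s t As At.
    by exists t; split.
  by exists s; split.
have U2 u v : U u -> U v -> exists s, [/\ A s, dom s u & dom s v].
  move=> [s As su] [t At tv]; have [r [Ar sr tr]] := join s t As At.
  by exists r; split; [|exact: sr|exact: tr].
have U3 u v w : U u -> U v -> U w ->
    exists s, [/\ A s, dom s u, dom s v & dom s w].
  move=> Hu Hv [t At tw]; have [s [As su sv]] := U2 u v Hu Hv.
  have [r [Ar sr tr]] := join s t As At.
  by exists r; split; [|exact: sr|exact: sr|exact: tr].
pose q u v :=
  xget 0 [set a | exists s, [/\ A s, dom s u, dom s v & a = fn s u v]].
have qE s u v : A s -> dom s u -> dom s v -> q u v = fn s u v.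
  move=> As su sv; rewrite /q.
  case: xgetP => [_ _ [t [At tu tv ->]]|/(_ (fn s u v))[]].
    exact: agree.
  by exists s.
have UP : lifts_on U q.
  split.
  - by exists s0 => //; rewrite /dom; case: (svalP s0).
  - move=> a u v Hu Hv; have [s [As su sv]] := U2 u v Hu Hv.
    by exists s => //; case: (svalP s) => _ + _ _ _; apply.
  - move=> a u v w Hu Hv Hw; have [s [As su sv sw]] := U3 u v w Hu Hv Hw.
    have [_ Uc ql _ _] := svalP s.
    by rewrite !(qE s) //; [exact: ql | exact: Uc].
  - move=> u v Hu Hv; have [s [As su sv]] := U2 u v Hu Hv.
    by rewrite !(qE s) //; case: (svalP s) => _ _ _ + _; apply.
  - move=> v [s As sv]; rewrite (qE s) //.
    by case: (svalP s) => _ _ _ _; apply.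
exists (exist _ (U, q) UP) => s As; apply/sub_liftP.
split=> /= [u su|u v su sv].
  by exists s.
exact: qE.
Qed.

(** A maximal partial lift is defined everywhere, since otherwise a missing
    vector could be adjoined. *)
Lemma quadratic_pair_lift : exists q : E -> E -> F,
  [/\ sesquilinear sigma q,
      forall v w, omega v w = q v w + eps * sigma (q w v) &
      forall v, q v v - Q v \in Lambda].
Proof.
have [[[U q] Uq] tmax] :=
  ZL_preorder (exist _ (_, _) lifts_on0) sub_lift_refl sub_lift_trans
    sub_lift_chain.
have UT : U = setT.
  apply/seteqP; split=> // x _; apply: contrapT => Ux.
  have [V [p [Vp UV Vx pq]]] := lifts_on_adjoin Uq Ux.
  have /sub_liftP[/= VU _] : sub_lift (exist _ (V, p) Vp) (exist _ (U, q) Uq).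
    by apply: tmax; apply/sub_liftP.
  exact/Ux/VU.
have qT : lifts_on setT q by rewrite -UT.
exists q; split; first exact: lifts_on_sesq.
  by case: qT => _ _ _ qh _ v w; rewrite qh // subrK.
by case: qT => _ _ _ _ qQ v; apply: qQ.
Qed.

End Lift.

(** * The universal property of Form *)

Section FormQuotient.
Variables (F : fieldType) (sigma : involutive_rmorphism F) (eps : F).
Variable Lambda : zmodClosed F.

(** The isomorphism is induced by [T]: two representatives of a class differ by
    an element of the kernel of [T]. *)
Lemma Form_iso (B : vect_presheaf F)
    (T : forall E : lmodType F, {additive Sesq sigma E -> B E}) :
  (forall (E E' : lmodType F) (f : {linear E -> E'}) q,
     T E (sesq_pull f q) = pull B f (T E' q)) ->
  (forall E q, T E q = 0 <-> q \in @is_null F sigma eps Lambda E) ->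
  (forall E b, exists q, T E q = b) ->
  naturally_isomorphic (Form_functor sigma eps Lambda) B.
Proof.
move=> Tnat Tker Tsurj.
pose phi E (x : Form sigma eps Lambda E) : B E := T E (repr x).
have phiE E q : phi E (\pi_(Form sigma eps Lambda E)%qT q) = T E q.
  apply/eqP; rewrite -subr_eq0 -raddfB; apply/eqP/Tker.
  by rewrite Quotient.idealrBE reprK.
have phiB E : zmod_morphism (phi E).
  by move=> x y; rewrite -[x]reprK -[y]reprK -raddfB !phiE raddfB.
pose phiA E : {additive Form sigma eps Lambda E -> B E} :=
  HB.pack (phi E) (GRing.isZmodMorphism.Build _ _ (phi E) (phiB E)).
exists phiA; split=> [E|E E' f x].
  rewrite /= /phi -setTT_bijective; split=> // [x y _ _|b _].
    move=> /eqP; rewrite -subr_eq0 -(raddfB (T E)) => /eqP/Tker.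
    by rewrite Quotient.idealrBE !reprK => /eqP.
  have [q <-] := Tsurj E b.
  by exists (\pi_(Form sigma eps Lambda E)%qT q) => //; exact: phiE.
change (phi E (form_pull f x) = pull B f (phi E' x)).
by rewrite -[x]reprK form_pull_pi !phiE Tnat.
Qed.

End FormQuotient.

(** * Maps from sesquilinear forms to the three kinds of forms *)

Section Hermitize.
Variables (F : fieldType) (sigma : involutive_rmorphism F) (c : F).
Variable E : lmodType F.

Lemma hermitize_subproof (q : Sesq sigma E) :
  (fun v w => c * q v w + sigma (c * q w v)) \in @is_herm F sigma E.
Proof.
case: q => q /= /asboolP qs; apply/asboolP; split=> [|v w]; last first.
  by rewrite rmorphD /= rmorphK addrC.
have [qDl qDr qZ] := (sesquilinearP sigma q).1 qs.
apply/sesquilinearP; split=> [v v' w|v w w'|a b v w].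
- by rewrite qDl qDr !rmorphM !rmorphD /=; ring.
- by rewrite qDl qDr !rmorphM !rmorphD /=; ring.
- by rewrite !qZ !rmorphM /= rmorphK; ring.
Qed.

(** For [sigma c = eps * c] this is [c] times the eps-symmetrization of [q]. *)
Definition hermitize q : Herm sigma E := MkHerm (hermitize_subproof q).

Lemma hermitize_zmod_morphism : zmod_morphism hermitize.
Proof.
move=> p q; apply/val_inj/funext => v; apply/funext => w /=.
by rewrite !fctE !rmorphM !rmorphB /=; ring.
Qed.
HB.instance Definition _ :=
  GRing.isZmodMorphism.Build _ _ hermitize hermitize_zmod_morphism.

End Hermitize.

Lemma sesquilinear_id (F : fieldType) (sigma : involutive_rmorphism F)
    (E : lmodType F) (q : E -> E -> F) : sigma =1 id ->
  sesquilinear sigma q <-> bilinear_for *%R *%R q.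
Proof.
move=> s1; split=> -[ql qr]; split=> // w a u v.
  by rewrite ql /= s1.
by rewrite ql /= s1.
Qed.

Section SymmetricCase.
Variables (F : fieldType) (sigma : involutive_rmorphism F).
Hypothesis sigma_id : sigma =1 id.
Variable E : lmodType F.

Lemma antisymmetrize_subproof (q : Sesq sigma E) :
  (fun v w => q v w - q w v) \in @is_alt F E.
Proof.
case: q => q /= /asboolP qs; apply/asboolP; split=> [|v]; last exact: subrr.
apply/(sesquilinear_id _ sigma_id)/sesquilinearP.
have [qDl qDr qZ] := (sesquilinearP sigma q).1 qs.
split=> [v v' w|v w w'|a b v w]; rewrite ?qZ ?qDl ?qDr ?sigma_id; ring.
Qed.
Definition antisymmetrize q : Alt E := MkAlt (antisymmetrize_subproof q).

Lemma antisymmetrize_zmod_morphism : zmod_morphism antisymmetrize.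
Proof.
move=> p q; apply/val_inj/funext => v; apply/funext => w /=.
by rewrite !fctE; ring.
Qed.
HB.instance Definition _ :=
  GRing.isZmodMorphism.Build _ _ antisymmetrize antisymmetrize_zmod_morphism.

Lemma diagonal_subproof (q : Sesq sigma E) :
  (fun v => q v v) \in @is_quad F E.
Proof.
case: q => q /= /asboolP qs; apply/asboolP.
have [qDl qDr qZ] := (sesquilinearP sigma q).1 qs.
split=> [a v|]; first by rewrite qZ sigma_id; ring.
have polarE v w : polar (fun u => q u u) v w = q v w + q w v.
  by rewrite /polar qDl !qDr; ring.
apply/(sesquilinear_id _ sigma_id)/sesquilinearP.
split=> [v v' w|v w w'|a b v w]; rewrite !polarE ?qZ ?qDl ?qDr ?sigma_id; ring.
Qed.
Definition diagonal q : Quad E := MkQuad (diagonal_subproof q).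

Lemma diagonal_zmod_morphism : zmod_morphism diagonal.
Proof. by move=> p q; apply/val_inj. Qed.
HB.instance Definition _ :=
  GRing.isZmodMorphism.Build _ _ diagonal diagonal_zmod_morphism.

End SymmetricCase.

(** * Scalars when the involution is nontrivial *)

Section Scalars.
Variables (F : fieldType) (sigma : involutive_rmorphism F) (eps : F).
Hypothesis sigma_nontriv : ~ (sigma =1 id).

(** If all traces vanished, [sigma x = - x] for every [x], and [x = 1] would
    give [-1 = 1], so that sigma would be the identity.  A nonzero trace is fixed by
    sigma, hence one may divide by it. *)
Lemma exists_trace1 : exists a, a + sigma a = 1.
Proof.
have [t tn0] : exists t, t + sigma t != 0.
  apply: contrapT => /forallNP h.
  have {}h t : sigma t = - t.
    by have /negP := h t; rewrite negbK addrC addr_eq0 => /eqP.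
  apply: sigma_nontriv => x; rewrite h.
  by have := h 1; rewrite rmorph1 => e; rewrite -mulN1r -e mul1r.
exists (t / (t + sigma t)).
rewrite rmorphM fmorphV rmorphD /= rmorphK [sigma t + t]addrC -mulrDl.
exact: divff.
Qed.

(** Hilbert 90 for the extension of degree 2 defined by sigma: the element
    [x + sigma (eps * x)] is a solution for every [x], and these cannot all
    vanish, by independence of sigma and the identity. *)
Lemma exists_hilbert90 : eps * sigma eps = 1 ->
  exists2 c, c != 0 & sigma c = eps * c.
Proof.
move=> heps; have [x xn0] : exists x, x + sigma (eps * x) != 0.
  apply: contrapT => /forallNP h.
  have {}h x : sigma (eps * x) = - x.
    by have /negP := h x; rewrite negbK addrC addr_eq0 => /eqP.
  apply: sigma_nontriv => x.
  have := h 1; rewrite mulr1 => e.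
  by have := h x; rewrite rmorphM /= e mulN1r => /oppr_inj.
exists (x + sigma (eps * x)) => //.
rewrite rmorphD /= rmorphK mulrDr rmorphM /= mulrA heps mul1r.
exact: addrC.
Qed.

(** If [a] has trace 1 and [eps * sigma b = - b], then
    [a * b - eps * sigma (a * b) = (a + sigma a) * b = b]. *)
Lemma Lambda_max_sub_min : Lambda_max sigma eps `<=` Lambda_min sigma eps.
Proof.
have [a ha] := exists_trace1.
move=> b /eqP; rewrite addrC addr_eq0 => /eqP hb.
exists (a * b) => //.
by rewrite rmorphM mulrCA hb mulrN opprK -mulrDl ha mul1r.
Qed.

End Scalars.

(** * The three isomorphisms *)

Section Isomorphisms.
Variables (F : fieldType) (sigma : involutive_rmorphism F) (eps : F).
Variable Lambda : zmodClosed F.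

(** The inverse sends [h] to the class of [a / c * h], for the [a] of trace 1
    and the [c] of Hilbert 90. *)
Lemma Form_Herm : eps * sigma eps = 1 ->
  Lambda_min sigma eps `<=` [set` Lambda] -> ~ (sigma =1 id) ->
  naturally_isomorphic (Form_functor sigma eps Lambda) (Herm_functor sigma).
Proof.
move=> heps hmin s1; have [a ha] := exists_trace1 s1.
have [c cn0 hc] := exists_hilbert90 s1 heps.
have cE x y : c * x + sigma (c * y) = c * (x + eps * sigma y).
  by rewrite rmorphM /= hc; ring.
apply: (@Form_iso _ _ _ _ (Herm_functor sigma)
  (fun E => @hermitize F sigma c E : {additive _ -> _})).
- by move=> E E' f q; apply/val_inj.
- move=> E q; split=> [q0|/asboolP[_ qh]]; last first.
    apply/val_inj/funext => v; apply/funext => w.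
    by rewrite /= cE qh mulNr addNr mulr0.
  have qh v w : q w v = - eps * sigma (q v w).
    have /(congr1 (fun h : Herm sigma E => h w v)) /= := q0.
    by rewrite cE => /eqP; rewrite mulf_eq0 (negPf cn0) addr_eq0 mulNr => /eqP.
  apply/asboolP; split=> // v; apply/hmin/(Lambda_max_sub_min s1).
  by rewrite /Lambda_max /= {1}qh mulNr addNr.
- move=> E h; have /asboolP[hs hh] := hermP h.
  have qs : (fun v w => a / c * h v w) \in @is_sesq F sigma E.
    have [hDl hDr hZ] := (sesquilinearP sigma h).1 hs.
    apply/asboolP/sesquilinearP.
    by split=> [v v' w|v w w'|x y v w]; rewrite ?hDl ?hDr ?hZ; ring.
  exists (MkSesq qs); apply/val_inj/funext => v; apply/funext => w /=.
  rewrite !mulrA ![c * a]mulrC !mulfK // rmorphM /= -hh -mulrDl ha.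
  exact: mul1r.
Qed.

Lemma Form_Alt : sigma =1 id -> eps = -1 -> [set` Lambda] = setT ->
  naturally_isomorphic (Form_functor sigma eps Lambda) (Alt_functor F).
Proof.
move=> s1 e1 L1.
have LT x : x \in Lambda by have : [set` Lambda] x by rewrite L1.
apply: (@Form_iso _ _ _ _ (Alt_functor F)
  (fun E => @antisymmetrize F sigma s1 E : {additive _ -> _})).
- by move=> E E' f q; apply/val_inj.
- move=> E q; split=> [q0|/asboolP[_ qh]].
    apply/asboolP; split=> // v w; rewrite e1 opprK mul1r s1.
    have /(congr1 (fun h : Alt E => h w v)) /= /eqP := q0.
    by rewrite subr_eq0 => /eqP.
  apply/val_inj/funext => v; apply/funext => w /=.
  by rewrite qh s1 e1 opprK mul1r subrr.
- move=> E omega; have /asboolP[ob oa] := Defs.altP omega.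
  have os := (sesquilinear_id omega s1).2 ob.
  have [oDl oDr _] := (sesquilinearP sigma omega).1 os.
  (* With [Lambda] the whole field, [Q] carries no information. *)
  have pair : quadratic_pair sigma eps Lambda omega (fun=> 0).
    split=> // [v w|v]; rewrite e1 s1 mulN1r; last by rewrite oa subr0.
    apply/eqP; rewrite -addr_eq0; apply/eqP.
    by have := oa (v + w); rewrite oDl !oDr !oa addr0 add0r.
  have [q [qs qo _]] := quadratic_pair_lift pair.
  have qS : q \in @is_sesq F sigma E by apply/asboolP.
  exists (MkSesq qS); apply/val_inj/funext => v; apply/funext => w /=.
  by rewrite [RHS]qo e1 s1 mulN1r.
Qed.

(** The kernel is right because a form that vanishes on the diagonal is
    alternating, hence antisymmetric. *)
Lemma Form_Quad : sigma =1 id -> eps = 1 -> [set` Lambda] = [set 0] ->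
  naturally_isomorphic (Form_functor sigma eps Lambda) (Quad_functor F).
Proof.
move=> s1 e1 L0; have L0P x : x \in Lambda <-> x = 0.
  split=> [xL|->]; last exact: rpred0.
  by have : [set` Lambda] x by []; rewrite L0.
apply: (@Form_iso _ _ _ _ (Quad_functor F)
  (fun E => @diagonal F sigma s1 E : {additive _ -> _})).
- by move=> E E' f q; apply/val_inj.
- move=> E q; split=> [q0|/asboolP[qL _]].
    have qd v : q v v = 0 by have /(congr1 (fun h : Quad E => h v)) := q0.
    apply/asboolP; split=> [v|v w]; first exact/L0P.
    have /asboolP/sesquilinearP[qDl qDr _] := sesqP q.
    rewrite e1 mulN1r s1; apply/eqP; rewrite -addr_eq0; apply/eqP.
    by have := qd (w + v); rewrite qDl !qDr !qd addr0 add0r.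
  by apply/val_inj/funext => v; apply/L0P/qL.
- move=> E Q; have /asboolP[QZ Qb] := quadP Q.
  have pair : quadratic_pair sigma eps Lambda (polar Q) Q.
    split.
    + exact/sesquilinear_id.
    + by move=> v w; rewrite e1 mul1r s1 /polar addrC [v + w]addrC; ring.
    + move=> v; rewrite e1 mul1r s1 /polar -[v + v](scaler_nat 2%N) QZ; ring.
    + by move=> a v; apply/L0P; rewrite QZ s1; ring.
    + by move=> v w; apply/L0P; rewrite /polar; ring.
  have [q [qs _ qQ]] := quadratic_pair_lift pair.
  have qS : q \in @is_sesq F sigma E by apply/asboolP.
  exists (MkSesq qS); apply/val_inj/funext => v /=.
  by apply/eqP; rewrite -subr_eq0; apply/eqP/L0P/qQ.
Qed.

End Isomorphisms.

Theorem theorem1 (F : fieldType) (sigma : involutive_rmorphism F) (eps : F)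
    (Lambda : zmodClosed F)
    (heps : eps * sigma eps = 1)
    (hmin : Lambda_min sigma eps `<=` [set` Lambda])
    (hmax : [set` Lambda] `<=` Lambda_max sigma eps) :
  [/\ ~ (sigma =1 id) ->
        naturally_isomorphic (Form_functor sigma eps Lambda) (Herm_functor sigma),
      sigma =1 id -> eps = -1 -> [set` Lambda] = setT ->
        naturally_isomorphic (Form_functor sigma eps Lambda) (Alt_functor F) &
      sigma =1 id -> eps = 1 -> [set` Lambda] = [set 0] ->
        naturally_isomorphic (Form_functor sigma eps Lambda) (Quad_functor F)].
Proof.
split; [exact: Form_Herm | exact: Form_Alt | exact: Form_Quad].
Qed.
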